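(* Let $W$ be a widely-connected space and let $\gamma W$ be an irreducible compactification of $W$. Then $\gamma W$ is irreducible between two points of the remainder $\gamma W\setminus W$; that is, there are two distinct points $p,q\in\gamma W\setminus W$ such that $\gamma W$ is irreducible between $p$ and $q$.
   Context: A connected topological space $W$ is widely-connected if every non-degenerate connected subset of $W$ (one with more than one point) is dense in $W$. A compactification of $W$ is a compact Hausdorff space in which $W$ is densely embedded. A continuum is a connected compact Hausdorff space. A composant of a continuum is the union of all its proper subcontinua that contain a given point. A connected space $Y$ is irreducible between two points $p,q\in Y$ if there is no closed connected $C\subsetneq Y$ with $\{p,q\}\subseteq C$. A continuum is irreducible if it has more than one composant, that is, if there are two (distinct) points between which it is irreducible. *)

(* Defs.v *)
From mathcomp Require Import all_boot all_order.
From mathcomp Require Import boolp classical_sets functions topology.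

Set Implicit Arguments.
Unset Strict Implicit.
Unset Printing Implicit Defensive.

Local Open Scope classical_set_scope.

Definition nondegenerate (T : Type) (A : set T) : Prop :=
  exists x y : T, [/\ A x, A y & x <> y].

Definition widely_connected (W : topologicalType) : Prop :=
  connected [set: W] /\
  forall A : set W, connected A -> nondegenerate A -> dense A.

(* Homeomorphism onto the image [range e], taken with the subspace topology. *)
Definition embedding (W X : topologicalType) (e : W -> X) : Prop :=
  [/\ injective e, continuous e &
      forall U : set W, open U ->
        exists2 V : set X, open V & e @` U = range e `&` V].

(* [X] is a compactification of [W], where [W] is identified with the dense
   subspace [range e]; the remainder is then [~` range e]. *)
Definition compactification (W X : topologicalType) (e : W -> X) : Prop :=
  [/\ compact [set: X], hausdorff_space X, embedding e & dense (range e)].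

Definition continuum (X : topologicalType) : Prop :=
  [/\ connected [set: X], compact [set: X] & hausdorff_space X].

(* Used in Hausdorff spaces only, so that [K] is automatically Hausdorff. The
   empty set satisfies [connected], but it contributes nothing to a composant. *)
Definition proper_subcontinuum (X : topologicalType) (K : set X) : Prop :=
  [/\ connected K, compact K & K <> [set: X]].

Definition composant (X : topologicalType) (p : X) : set X :=
  \bigcup_(K in [set K : set X | proper_subcontinuum K /\ K p]) K.

(* The points [p] and [q] are allowed to coincide here. *)
Definition irreducible_between (Y : topologicalType) (p q : Y) : Prop :=
  connected [set: Y] /\
  ~ exists C : set Y,
      [/\ closed C, connected C, C <> [set: Y] & [set p; q] `<=` C].

Definition irreducible_continuum (X : topologicalType) : Prop :=
  continuum X /\ exists p q : X, composant p <> composant q.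

(* Main.v *)
Require Import Defs.
From mathcomp Require Import all_boot all_order.
From mathcomp Require Import boolp classical_sets functions topology.

(** Why the theorem holds. Write [X] for the compactification and [D] for the
    copy of [W] inside it. All that matters about [D] is that it is connected,
    dense in [X], and that its nondegenerate connected subsets are again dense
    in [X] ([densely_widely_connected]).

    Suppose that [X] is irreducible between [p] and [q].

    The key point is that [X] is not a union of two proper subcontinua [L] and
    [C] with [p] in [L] ([not_union_proper_subcontinua]). The open set
    [V = X \ L] lies in [C], so [D] meets [V] in a set that is not dense in
    [X]; having more than one point, this set must be disconnected. If [S] and [S'] separate it, then
    [L] together with the closure of [S] is a continuum, because a piece split
    off from it would split off from [D] ([connectedU_closure_half]); the same
    holds for [S']. As [q] is in the closure of [S] or of [S'], irreducibility
    makes one of these continua all of [X], which leaves no room for the other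
    half of the separation.

    An endpoint [p] can now be pushed into the remainder. Some proper
    subcontinuum [L] contains [p] and a second point, but not [q]
    ([nondegenerate_subcontinuum]). It is not contained in [D], where it would
    be dense and hence equal to [X]; pick [p'] in [L \ D]. A proper
    subcontinuum [C] through [p'] and [q] would meet [L], so [L] and [C] would
    together form a continuum through [p] and [q], that is, cover [X], which the
    key point forbids. Hence [X] is irreducible between [p'] and [q]
    ([irreducible_from_remainder]). Moving both ends in this way gives the
    theorem. *)

Set Implicit Arguments.
Unset Strict Implicit.
Unset Printing Implicit Defensive.

Local Open Scope classical_set_scope.

(** * Closed, connected and dense sets *)

Lemma closed_separatedl (T : topologicalType) (F G : set T) :
  closed (F `|` G) -> separated F G -> closed F.
Proof.
move=> cFG [FG _] x Fx.
have [//|Gx] : (F `|` G) x by apply: cFG; apply: (closureS _ Fx) => y; left.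
by have : set0 x by rewrite -FG.
Qed.

(** To test connectedness, it suffices to look at separations in which a given
    connected subset lies on the first side. *)
Lemma connected_from (T : topologicalType) (A C : set T) :
  connected C -> C !=set0 -> C `<=` A ->
  (forall F G, separated F G -> A = F `|` G -> C `<=` F -> G = set0) ->
  connected A.
Proof.
move=> cC [x Cx] CA H; apply/connectedP => E [E0 EA sE].
have CE : C `<=` E false `|` E true by rewrite -EA.
have [CF|CG] := connected_subset sE CE cC.
- by have [y] := E0 true; rewrite (H _ _ sE EA CF).
- have [y] := E0 false; rewrite (H (E true) (E false)) //.
    by rewrite separatedC.
  by rewrite setUC.
Qed.

Lemma dense_closed_setT (T : topologicalType) (K : set T) :
  closed K -> dense K -> K = [set: T].
Proof.
move=> cK dK; apply/seteqP; split=> // x _; apply: cK => U.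
rewrite nbhsE => -[V [oV Vx] VU].
have [|y [Vy Ky]] := dK V _ oV; first by exists x.
by exists y; split=> //; apply: VU.
Qed.

Lemma open_sub_closure_dense (T : topologicalType) (D V : set T) :
  dense D -> open V -> V `<=` closure (D `&` V).
Proof.
move=> dD oV x Vx U; rewrite nbhsE => -[O [oO Ox] OU].
have [||y [[Oy Vy] Dy]] := dD (O `&` V).
- by exists x.
- exact: openI.
- by exists y; split=> //; apply: OU.
Qed.

(** * Small nondegenerate subcontinua *)

(** Otherwise the sets [H `\` U] generate a proper filter on [N], and any of its
    cluster points lies in all of these closed sets. *)
Lemma compact_directed_sub (T : topologicalType) (N : set T)
    (fam : set (set T)) (U : set T) :
  compact N -> fam !=set0 -> setI_closed fam ->
  (forall H, fam H -> closed H /\ H `<=` N) ->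
  open U -> \bigcap_(H in fam) H `<=` U ->
  exists2 H, fam H & H `<=` U.
Proof.
move=> cN [H0 famH0] famI famN oU famU; apply: contrapT => noH.
have ne H : fam H -> (H `\` U) !=set0.
  move=> famH; apply/set0P/eqP => HU0; apply: noH; exists H => // x Hx.
  by apply: contrapT => Ux; have : set0 x by rewrite -HU0.
pose F := filter_from fam (fun H => H `\` U).
have FF : ProperFilter F.
  apply: filter_from_proper => //; apply: filter_from_filter; first by exists H0.
  move=> A B hA hB; exists (A `&` B); first exact: famI.
  by move=> x [[Ax Bx] Ux].
have FN : F N by exists H0 => // x [/(famN _ famH0).2].
have [x [Nx Fx]] := cN F FF FN.
have HUx H : fam H -> (H `\` U) x.
  move=> famH; have cl : closed (H `\` U).
    by apply: closedI; [exact: (famN _ famH).1|exact: open_closedC].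
  by apply: cl => B Bx; apply: Fx => //; exists H.
by have [_ []] := HUx _ famH0; apply: famU => H /HUx[].
Qed.

(** A relatively clopen subset of [N], for [N] closed; being relatively closed
    then means being closed in the whole space. *)
Definition clopen_in (T : topologicalType) (N H : set T) : Prop :=
  closed H /\ exists2 U, open U & H = N `&` U.

Definition quasicomponent (T : topologicalType) (N : set T) (p : T) : set T :=
  \bigcap_(H in [set H | clopen_in N H /\ H p]) H.

Lemma quasicomponent_sub (T : topologicalType) (N U : set T) (p : T) :
  compact N -> closed N -> N p -> open U -> quasicomponent N p `<=` U ->
  exists H, [/\ clopen_in N H, H p & H `<=` U].
Proof.
move=> cN clN Np oU QU.
pose fam := [set H | clopen_in N H /\ H p].
have famN : fam N.
  split=> //; split=> //.
  by exists setT; [exact: openT|rewrite setIT].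
have famI : setI_closed fam.
  move=> A B [[cA [A' oA' eA]] Ap] [[cB [B' oB' eB]] Bp].
  split=> //; split; first exact: closedI.
  by exists (A' `&` B'); [exact: openI|rewrite eA eB setIACA setIid].
have [||H [HN Hp] HU] := compact_directed_sub cN _ famI _ oU QU.
- by exists N.
- by move=> H [[cH [V _ eH]] _]; split=> //; rewrite eH => x [].
- by exists H.
Qed.

Lemma quasicomponent_closed (T : topologicalType) (N : set T) (p : T) :
  closed (quasicomponent N p).
Proof. by apply: closed_bigI => H [[]]. Qed.

(** In a compact Hausdorff space quasicomponents are connected: separate two
    closed pieces by disjoint open sets. By compactness their union already
    contains a single relatively clopen set, which then splits along them. *)
Lemma quasicomponent_connected (T : topologicalType) (N : set T) (p : T) :
  compact [set: T] -> hausdorff_space T -> closed N -> N p ->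
  connected (quasicomponent N p).
Proof.
move=> cT hT clN Np.
have cN : compact N by apply: subclosed_compact cT _.
have cQ := @quasicomponent_closed T N p.
apply: (@connected_from _ _ [set p]) => [||x -> H []//|F G sFG eQ Fp].
- exact: connected1.
- by exists p.
have cF : closed F by apply: closed_separatedl sFG; rewrite -eQ.
have cG : closed G.
  by apply: (@closed_separatedl _ G F); rewrite 1?separatedC 1?setUC -?eQ.
have FG0 := separated_disjoint sFG.
have nG : set_nbhs F (~` G).
  apply/set_nbhsP; exists (~` G); split=> //; first exact: closed_openC.
  by move=> x Fx Gx; have : set0 x by rewrite -FG0.
have [B /set_nbhsP[C [oC FC CB]] BG] := compact_normal hT cT cF nG.
have [||H [[cH [V oV eH]] Hp HU]] := @quasicomponent_sub T N
   (C `|` ~` closure B) p cN clN Np.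
- by apply: openU => //; apply: closed_openC; apply: closed_closure.
- by rewrite eQ => x [/FC|Gx]; [left|right => /BG].
(* [H] misses the frontier of [C], so it splits along [C], and the half
   containing [p] is again relatively clopen. *)
have eHC : H `&` C = H `&` closure B.
  apply/seteqP; split=> x [Hx Cx]; split=> //; first exact/subset_closure/CB.
  by case: (HU _ Hx).
have QC : quasicomponent N p `<=` H `&` C.
  move=> x; apply; split; last by split=> //; apply: FC; apply: Fp.
  split; first by rewrite eHC; apply: closedI => //; exact: closed_closure.
  by exists (V `&` C); [exact: openI|rewrite eH setIA].
apply/seteqP; split=> // x Gx.
have [|_ Cx] := QC x; first by rewrite eQ; right.
by apply: BG Gx; apply/subset_closure/CB.
Qed.

(** A form of boundary bumping. Take the quasicomponent of [p] in a closed
    neighbourhood [N] of [p] that misses [q]. Were it only [{p}], some relatively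
    clopen subset of [N] would contain [p] and lie in an open subset of [N],
    hence be clopen in the whole connected space. *)
Lemma nondegenerate_subcontinuum (T : topologicalType) (p q : T) :
  compact [set: T] -> hausdorff_space T -> connected [set: T] -> p <> q ->
  exists L : set T, [/\ closed L, connected L, L p, ~ L q & nondegenerate L].
Proof.
move=> cT hT conT pq.
have nq : set_nbhs [set p] (~` [set q]).
  apply/set_nbhsP; exists (~` [set q]); split=> [||x //].
    by apply: closed_openC; apply: accessible_closed_set1; apply: hausdorff_accessible.
  by move=> x -> /= /pq.
have cp : closed [set p].
  by apply: accessible_closed_set1; apply: hausdorff_accessible.
have [B /set_nbhsP[O [oO pO OB]] Bq] := compact_normal hT cT cp nq.
pose N := closure B; have clN : closed N by exact: closed_closure.
have ON : O `<=` N by move=> x /OB; apply: subset_closure.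
have Op : O p by apply: pO.
have Np : N p by apply: ON.
have Qp : quasicomponent N p p by move=> H [].
have QN : quasicomponent N p `<=` N.
  move=> x; apply; split=> //; split=> //.
  by exists setT; [exact: openT|rewrite setIT].
exists (quasicomponent N p); split=> //.
- exact: quasicomponent_closed.
- exact: quasicomponent_connected.
- by move=> /QN /Bq; apply.
apply: contrapT => deg.
have QO : quasicomponent N p `<=` O.
  move=> x Qx; have [->//|xp] := pselect (x = p).
  by exfalso; apply: deg; exists x, p.
have [H [[cH [V oV eH]] Hp HO]] :=
  quasicomponent_sub (subclosed_compact clN cT (@subsetT _ _)) clN Np oO QO.
have HT : H = [set: T].
  apply: conT; first by exists p.
    exists (V `&` O); first exact: openI.
    rewrite setTI; apply/seteqP; split=> x.
      by move=> Hx; split; [move: Hx; rewrite eH => -[]|apply: HO].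
    by move=> [Vx Ox]; rewrite eH; split=> //; apply: ON.
  by exists H; rewrite ?setTI.
have : H q by rewrite HT.
by move=> /HO /ON /Bq; apply.
Qed.

(** * The image of a widely-connected space *)

Lemma embedding_connected_preimage (W X : topologicalType) (e : W -> X)
    (T : set X) :
  embedding e -> T `<=` range e -> connected T -> connected (e @^-1` T).
Proof.
move=> [inj_e ce oe] Te cT B [w Bw] [U oU eU] [C cC eC].
have im A : open A -> exists2 V, open V & forall x, A x <-> V (e x).
  move=> /oe[V oV eV]; exists V => // x; split=> [Ax|Vx].
    by have [] : (range e `&` V) (e x) by rewrite -eV; exists x.
  have [y Ay /inj_e <- //] : (e @` A) (e x) by rewrite eV; split=> //; exists x.
have [V oV UV] := im _ oU.
have [V' oV' CV'] := im _ (closed_openC cC).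
have eB : e @` B = T.
  apply: cT; first by exists (e w), w.
  - exists V => //; rewrite eU; apply/seteqP; split=> y.
      by move=> [x [Tx /UV Vx] <-].
    by move=> [/[dup] Ty /Te[x _ xy]]; rewrite -xy in Ty * => /UV Ux; exists x.
  - exists (~` V'); first exact: open_closedC.
    rewrite eC; apply/seteqP; split=> y.
      by move=> [x [Tx Cx] <-]; split=> // /CV'; apply.
    move=> [/[dup] Ty /Te[x _ xy]]; rewrite -xy in Ty * => nV; exists x => //.
    by split=> //; apply: contrapT => /CV'.
apply/seteqP; split=> x; first by rewrite eU => -[].
by move=> Tx; have [y By /inj_e <-] : (e @` B) (e x) by rewrite eB.
Qed.

Definition densely_widely_connected (X : topologicalType) (D : set X) : Prop :=
  [/\ connected D, dense D &
      forall S, S `<=` D -> connected S -> nondegenerate S -> dense S].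

Lemma range_densely_widely_connected (W X : topologicalType) (e : W -> X) :
  widely_connected W -> compactification e ->
  densely_widely_connected (range e).
Proof.
move=> [cW wW] [_ _ emb dD].
have [inj_e ce _] := emb.
split=> //.
  apply: connected_continuous_connected => //.
  exact: continuous_subspaceT.
move=> S SD cS [x [y [Sx Sy xy]]] O O0 oO.
have [v _ ev] := SD _ Sx; have [w _ ew] := SD _ Sy.
have dS : dense (e @^-1` S).
  apply: wW; first exact: embedding_connected_preimage emb SD cS.
  exists v, w; split; rewrite /= ?ev ?ew //.
  by move=> vw; apply: xy; rewrite -ev -ew vw.
have [y0 [Oz [z _ ez]]] := dD O O0 oO; rewrite -ez in Oz.
have [||t [Ot St]] := dS (e @^-1` O).
- by exists z.
- by move/continuousP: ce; apply.
- by exists (e t).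
Qed.

(** * Irreducibility *)

(** A variant, for [A] not contained in [D], of the classical fact that adding
    to a connected set [A] one half of a separation of its complement keeps it
    connected. If a piece [G] of [A `|` closure S] were split off away from [A],
    then [D `&` G] would be clopen in [D]: it only accumulates at points of [G],
    and near such a point [D] has neither points of [S'], which is separated
    from [S], nor points of the other piece. *)
Lemma connectedU_closure_half (T : topologicalType) (D A S S' : set T) :
  connected D -> connected A -> closed A -> D `&` A !=set0 ->
  D `\` A = S `|` S' -> separated S S' -> connected (A `|` closure S).
Proof.
move=> cD cA clA [a [Da Aa]] DA [SS' SS''].
apply: (@connected_from _ _ A) => //; first by exists a.
move=> F G sFG eFG AF.
have cFG : closed (F `|` G).
  by rewrite -eFG; apply: closedU => //; exact: closed_closure.
have cF := closed_separatedl cFG sFG.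
have cG : closed G.
  by apply: (@closed_separatedl _ G F); rewrite 1?separatedC 1?setUC.
have FG0 x : F x -> G x -> False.
  by move=> Fx Gx; have : set0 x by rewrite -(separated_disjoint sFG).
(* [D `&` G] is clopen in the connected set [D] and misses [a]. *)
have DG0 x : D x -> G x -> False.
  have sD : separated (D `&` G) (D `\` G).
    split; apply/seteqP; split=> // y [].
      move=> clDG [_]; apply; apply: cG.
      by apply: closureS clDG => z [].
    move=> [Dy Gy] clDG.
    have nAy : ~ A y by move=> /AF Fy; exact: FG0 Fy Gy.
    have : closure (F `|` S') y.
      apply: closureS clDG => z [Dz nGz].
      have [Az|nAz] := pselect (A z); first by left; apply: AF.
      have : (D `\` A) z by [].
      rewrite DA => -[Sz|]; last by right.
      have : (F `|` G) z by rewrite -eFG; right; apply: subset_closure.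
      by case=> // Fz; left.
    rewrite closureU -((closure_id _).1 cF) => -[Fy|S'y]; first exact: FG0 Fy Gy.
    have : (D `\` A) y by [].
    rewrite DA => -[Sy|S'y']; first by rewrite -SS''; split.
    have : (A `|` closure S) y by rewrite eFG; right.
    by case=> // clSy; rewrite -SS'; split.
  have DD : D `<=` (D `&` G) `|` (D `\` G).
    by move=> y Dy; have [] := pselect (G y); [left|right].
  move=> Dx Gx; have [DG|DG] := connected_subset sD DD cD.
    by apply: (@FG0 a); [exact: AF|case: (DG _ Da)].
  by have [] := DG _ Dx.
apply/seteqP; split=> // x Gx.
have : (A `|` closure S) x by rewrite eFG; right.
case=> [/AF Fx|clSx]; first exact: FG0 Fx Gx.
have [|y [Sy nFy]] := clSx (~` F).
  apply: open_nbhs_nbhs; split; first exact: closed_openC.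
  by move=> Fx; exact: FG0 Fx Gx.
apply: (@DG0 y).
  by have [] : (D `\` A) y by rewrite DA; left.
have : (F `|` G) y by rewrite -eFG; right; apply: subset_closure.
by case.
Qed.

Lemma irreducible_setT (Y : topologicalType) (p q : Y) (C : set Y) :
  irreducible_between p q -> closed C -> connected C -> C p -> C q ->
  C = [set: Y].
Proof.
move=> [_ nC] clC cC Cp Cq; apply: contrapT => CT; apply: nC.
by exists C; split=> // x [->|->].
Qed.

Lemma irreducible_between_sym (Y : topologicalType) (p q : Y) :
  irreducible_between p q -> irreducible_between q p.
Proof. by rewrite /irreducible_between setUC. Qed.

(** This amounts to the indecomposability of [X]: of two proper subcontinua that
    cover [X], [L] is one that contains [p]; by irreducibility it misses [q]. The
    trace of [D] on the complement of [L] can be neither connected nor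
    disconnected. *)
Lemma not_union_proper_subcontinua (X : topologicalType) (D L C : set X)
    (p q : X) :
  accessible_space X -> densely_widely_connected D -> irreducible_between p q ->
  closed L -> connected L -> L p -> ~ L q ->
  closed C -> C <> [set: X] -> L `|` C <> [set: X].
Proof.
move=> aX [cD dD wD] irr clL cL Lp Lq clC CT LC.
have [cX _] := irr.
pose V := ~` L; have oV : open V by exact: closed_openC.
have VC : V `<=` C.
  by move=> x Lx; have [/Lx|] : (L `|` C) x by rewrite LC.
have VcS : V `<=` closure (D `\` L) by exact: open_sub_closure_dense.
have cS : connected (D `\` L).
  apply: contrapT => /connectedPn[E [E0 ES sE]].
  have DL : D `&` L !=set0.
    have [||x [Cx Dx]] := dD (~` C).
    - by apply/set0P/eqP => C0; apply: CT; rewrite -(setCK C) C0 setC0.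
    - exact: closed_openC.
    - by exists x; split=> //; apply: contrapT => /VC.
  (* No half can accumulate at [q]: with [L] it would fill [X] and so contain
     the other half in its closure. *)
  have E'0 b : D `\` L = E b `|` E (~~ b) by case: b; rewrite // setUC.
  have E's b : separated (E b) (E (~~ b)) by case: b => //; rewrite separatedC.
  have nEq b : ~ closure (E b) q.
    move=> Eq.
    have LE : L `|` closure (E b) = [set: X].
      apply: (irreducible_setT irr); [| |by left|by right].
        by apply: closedU => //; exact: closed_closure.
      exact: connectedU_closure_half cD cL clL DL (E'0 b) (E's b).
    have [y Ey] := E0 (~~ b).
    have [Dy Ly] : (D `\` L) y by rewrite (E'0 b); right.
    have : (L `|` closure (E b)) y by rewrite LE.
    case=> // cly; have [E1 _] := E's b.
    by have : set0 y by rewrite -E1.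
  have := VcS _ Lq; rewrite ES closureU => -[]; exact: nEq.
(* As [D `\` L] is connected, it is dense or at most a point. If dense, then so
   is the closed set [C]; if a point, that point is clopen in [X]. *)
have [nS|dS] := pselect (nondegenerate (D `\` L)).
  have dS : dense (D `\` L) by apply: wD => // x [].
  apply/CT/dense_closed_setT => // O O0 oO.
  have [x [Ox [Dx Lx]]] := dS O O0 oO.
  by exists x; split=> //; apply: VC.
have [s Ss] : D `\` L !=set0.
  by have [x [Lx Dx]] := dD V (ex_intro _ q Lq) oV; exists x.
have S1 : D `\` L `<=` [set s].
  by move=> x Sx; apply: contrapT => xs; apply: dS; exists x, s.
have c1 : closed [set s] by exact: accessible_closed_set1.
have Vs : V = [set s].
  apply/seteqP; split=> x; last by move=> ->; case: Ss.
  by move=> /VcS /(closureS S1); rewrite -((closure_id _).1 c1).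
have VT : V = [set: X].
  apply: cX; first by exists q.
    by exists V => //; rewrite setTI.
  by exists V; rewrite ?setTI// Vs.
by have : V p by rewrite VT.
Qed.

(** Any [p'] outside [D] in a proper nondegenerate subcontinuum through [p]
    works, and such a point exists because that subcontinuum is not dense. *)
Lemma irreducible_from_remainder (X : topologicalType) (D : set X) (p q : X) :
  compact [set: X] -> hausdorff_space X -> densely_widely_connected D ->
  irreducible_between p q -> p <> q ->
  exists p', [/\ ~ D p', p' <> q & irreducible_between p' q].
Proof.
move=> coX hX wD irr pq; have [cX _] := irr.
have [L [clL cL Lp Lq ndL]] := nondegenerate_subcontinuum coX hX cX pq.
have [p' Lp' nDp'] : exists2 p', L p' & ~ D p'.
  apply: contrapT => LD; apply: Lq; rewrite (@dense_closed_setT _ L) //.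
  have [_ _] := wD; apply => // x Lx; apply: contrapT => nDx.
  by apply: LD; exists x.
exists p'; split=> //; first by move=> p'q; rewrite p'q in Lp'.
split=> // -[C [clC cC CT pqC]].
have Cp' : C p' by apply: pqC; left.
have Cq : C q by apply: pqC; right.
apply: (not_union_proper_subcontinua (hausdorff_accessible hX) wD irr
  clL cL Lp Lq clC CT).
apply: (irreducible_setT irr); [exact: closedU| |by left|by right].
by apply: connectedU => //; exists p'.
Qed.

(** If no two distinct points had this property, every composant would be the
    whole space. *)
Lemma irreducible_continuum_points (X : topologicalType) :
  irreducible_continuum X ->
  exists p q : X, p <> q /\ irreducible_between p q.
Proof.
move=> [[cX coX hX] [a [b ab]]].
have key (x y : X) : ~ composant x y -> irreducible_between x y.
  move=> nxy; split=> // -[C [clC cC CT xyC]]; apply: nxy.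
  exists C; last by apply: xyC; right.
  split; last by apply: xyC; left.
  by split=> //; apply: subclosed_compact coX _.
apply: contrapT => no; apply: ab.
have full (x y : X) : x <> y -> composant x y.
  by move=> xy; apply: contrapT => /key irr; apply: no; exists x, y.
have composantT (x y : X) : x <> y -> composant x = [set: X].
  move=> xy; apply/seteqP; split=> // z _.
  have [<-|] := pselect (x = z); last exact: full.
  by have [K [Kp Kx] _] := full _ _ xy; exists K.
have [->//|ab] := pselect (a = b).
by rewrite (composantT _ _ ab) (composantT _ _ (nesym ab)).
Qed.

Theorem corollary7 (W gW : topologicalType) (e : W -> gW)
    (hW : widely_connected W)
    (hgW : compactification e)
    (hirr : irreducible_continuum gW) :
  exists p q : gW,
    [/\ (~` range e) p, (~` range e) q, p <> q & irreducible_between p q].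
Proof.
have wD := range_densely_widely_connected hW hgW.
have [p [q [pq irr]]] := irreducible_continuum_points hirr.
have [[_ coX hX] _] := hirr.
have [p' [Dp' p'q irr']] := irreducible_from_remainder coX hX wD irr pq.
have [q' [Dq' q'p' irr'']] := irreducible_from_remainder coX hX wD
  (irreducible_between_sym irr') (nesym p'q).
by exists q', p'.
Qed.
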